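(* A poset $P$ is a full monoid poset if and only if $P$ is a semigroup poset with a global minimum.
   Context: For a semigroup $T$ and a subsemigroup $S<T$ ($S=T$ allowed), define $t\leq_S t' :\iff \exists s\in S:\ ts=t'$ on $T$. The notation $P(T,S)$ is used only when $\leq_S$ is a partial order on $T$, and then denotes $(T,\leq_S)$. A poset is a semigroup poset if it is isomorphic to some $P(T,S)$; it is a full monoid poset if it is isomorphic to $P(M,M)$ for some monoid $M$. *)

(* Defs.v *)
From HB Require Import structures.
From mathcomp Require Import all_boot all_order.
From mathcomp Require Import boolp classical_sets.

Set Implicit Arguments.
Unset Strict Implicit.
Unset Printing Implicit Defensive.

(* Posets are MathComp's porderTypes and semigroups its semigroupTypes, whose
   relations are boolean and whose carriers are choiceTypes.  Under the axioms
   of boolp every type is a choiceType and every proposition is decidable, so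
   neither is a restriction; in particular nothing is assumed finite. *)

Local Open Scope group_scope.
Local Open Scope classical_set_scope.

Definition subsemigroup (T : semigroupType) (S : set T) : Prop :=
  mulg_closed [in S].

(* S acts by multiplication on the right. *)
Definition leS (T : semigroupType) (S : set T) : rel T :=
  fun t t' => `[< exists2 s : T, S s & t * s = t' >].

Definition partial_order (T : Type) (r : rel T) : Prop :=
  [/\ reflexive r, antisymmetric r & transitive r].

(* The notation P(T,S) presupposes that leS S is a partial order, hence the
   first conjunct. *)
Definition isomorphic_to_P (d : Order.disp_t) (P : porderType d)
    (T : semigroupType) (S : set T) : Prop :=
  partial_order (leS S) /\
  exists f : P -> T,
    bijective f /\ {mono f : x y / (x <= y)%O >-> leS S x y}.

Definition semigroup_poset (d : Order.disp_t) (P : porderType d) : Prop :=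
  exists (T : semigroupType) (S : set T),
    subsemigroup S /\ isomorphic_to_P P S.

Definition full_monoid_poset (d : Order.disp_t) (P : porderType d) : Prop :=
  exists M : monoidType, isomorphic_to_P P [set: M].

Definition has_global_minimum (d : Order.disp_t) (P : porderType d) : Prop :=
  exists m : P, forall x : P, (m <= x)%O.

(* Main.v *)
Require Import Defs.
From HB Require Import structures.
From mathcomp Require Import all_boot all_order.
From mathcomp Require Import boolp classical_sets.

(** A poset [P(M, M)] of a monoid has the identity of [M] as global minimum.

    Conversely, suppose that [P(T, S)] has a global minimum [m], so that
    [m S = T]. Then [T] already is a monoid with identity [m], and [S = T]:
    - if [e] in [S] satisfies [m e = m] and [s] in [S] satisfies [m s = e],
      then [(m m) s = m e = m], so [m m <= m]; hence [m m = m] by minimality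
      ([leS_minimum_idem]);
    - [m] is a left identity because [T = m S] ([leS_minimum_mul1]), thus
      [m s = s] for [s] in [S] and [T = m S = S] ([leS_minimum_full]);
    - [m] is a right identity: [t <= t m], and [t m <= t] because a witness
      [s] of [t <= t] satisfies [t m s = t s = t] ([leS_minimum_mulr1]).
    Both posets are thus literally the same relation on the same carrier. *)

Set Implicit Arguments.
Unset Strict Implicit.
Unset Printing Implicit Defensive.

Local Open Scope group_scope.
Local Open Scope classical_set_scope.

Section GlobalMinimum.

Variables (T : semigroupType) (S : set T) (m : T).
Hypotheses (leS_po : partial_order (leS S)) (m_min : forall t, leS S m t).

Lemma leS_minimum_idem : m * m = m.
Proof.
case: leS_po => _ leS_anti _; apply: leS_anti; rewrite m_min andbT.
have /asboolP[e Se me] := m_min m; have /asboolP[s Ss ms] := m_min e.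
by apply/asboolP; exists s; rewrite // -mulgA ms.
Qed.

Lemma leS_minimum_mul1 : left_id m *%g.
Proof.
by move=> t; have /asboolP[s _ <-] := m_min t; rewrite mulgA leS_minimum_idem.
Qed.

Lemma leS_minimum_full : S = [set: T].
Proof.
apply/seteqP; split=> // t _; have /asboolP[s Ss <-] := m_min t.
by rewrite leS_minimum_mul1.
Qed.

Lemma leS_minimum_mulr1 : right_id m *%g.
Proof.
case: leS_po => leS_refl leS_anti _ t; apply: leS_anti; apply/andP; split.
  have /asboolP[s Ss ts] := leS_refl t.
  by apply/asboolP; exists s; rewrite // -mulgA leS_minimum_mul1.
by apply/asboolP; exists m; rewrite ?leS_minimum_full.
Qed.

(** The monoid on the carrier of [T], with the multiplication of [T] and
    identity [m]. *)
Definition minimum_monoid : monoidType :=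
  HB.pack (Semigroup.sort T)
    (Magma_isUMagma.Build T leS_minimum_mul1 leS_minimum_mulr1).

End GlobalMinimum.

Lemma full_monoid_poset_semigroup (d : Order.disp_t) (P : porderType d) :
  full_monoid_poset P -> semigroup_poset P.
Proof.
by move=> [M isoP]; exists M, [set: M]; split=> // x y _ _; apply/mem_set.
Qed.

Lemma full_monoid_poset_minimum (d : Order.disp_t) (P : porderType d) :
  full_monoid_poset P -> has_global_minimum P.
Proof.
move=> [M [_ [f [[g _ gK] f_mono]]]]; exists (g 1) => x.
by rewrite -f_mono gK; apply/asboolP; exists (f x); rewrite ?mul1g.
Qed.

Lemma semigroup_poset_full_monoid (d : Order.disp_t) (P : porderType d) :
  semigroup_poset P -> has_global_minimum P -> full_monoid_poset P.
Proof.
move=> [T [S [_ [leS_po [f [f_bij f_mono]]]]]] [m m_min].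
have fm_min t : leS S (f m) t.
  by have [g _ gK] := f_bij; rewrite -(gK t) f_mono.
exists (minimum_monoid leS_po fm_min).
have S_full := leS_minimum_full leS_po fm_min; subst S.
by split; last exists f.
Qed.

Theorem theorem2p8 (d : Order.disp_t) (P : porderType d) :
  full_monoid_poset P <-> (semigroup_poset P /\ has_global_minimum P).
Proof.
split=> [P_full | [P_semi P_min]]; last exact: semigroup_poset_full_monoid.
split; first exact: full_monoid_poset_semigroup.
exact: full_monoid_poset_minimum.
Qed.
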